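(* Let $k\ge 1$. Let $G=([n],E)$ be a graph, and let $\Gamma(v)$ denote the set of neighbours of a vertex $v$. Suppose that every non-edge $\{i,j\}\notin E$ (with $i\ne j$) satisfies $|\Gamma(i)\cap\Gamma(j)|\le k$. If $|E|\ge 8n\sqrt{kn}$, then $G$ contains a clique of size at least $\frac14\frac{|E|}{n}$.
   Context: $[n]=\{1,\dots,n\}$ with $n\ge1$; graphs are finite and simple. *)

(* Defs.v *)
From mathcomp Require Import all_boot all_order all_algebra.

Set Implicit Arguments.
Unset Strict Implicit.
Unset Printing Implicit Defensive.

(* A finite simple graph on T is given by its edge set E, a set of 2-element
   subsets of T (this excludes loops and multiple edges). *)
Definition is_graph (T : finType) (E : {set {set T}}) : Prop :=
  forall A : {set T}, A \in E -> #|A| = 2.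

(* [set v; v] is a singleton, so v is never its own neighbour when E is a
   graph. *)
Definition nbrs (T : finType) (E : {set {set T}}) (v : T) : {set T} :=
  [set u | [set v; u] \in E].

Definition is_clique (T : finType) (E : {set {set T}}) (S : {set T}) : Prop :=
  forall i j : T, i \in S -> j \in S -> i != j -> [set i; j] \in E.

(* Main.v *)
Require Import Defs.
From mathcomp Require Import all_boot all_order all_algebra.
From mathcomp Require Import zify ring.
Import Order.TTheory GRing.Theory Num.Theory.
Local Open Scope ring_scope.

(** Write n for the number of vertices and e for the number of edges. Some
    nonempty vertex set U spans a subgraph of minimum degree at least e/n
    ([exists_min_degree_subgraph]). Let S be an independent subset of U of
    maximum size s, and for v in S let P(v) be the set of neighbours of v in U
    that are adjacent to no other element of S.

    Each P(v) is a clique: if x and y were distinct nonadjacent vertices of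
    P(v), then replacing v by x and y in S would give a larger independent set
    ([clique_private_part]). So it is enough to see that P(v) is large. Passing
    from the neighbourhood of v in U to P(v) costs at most k vertices for each
    other element of S, because elements of S are pairwise nonadjacent; hence
    |P(v)| >= e/n - sk ([card_private_nbrs]).

    It remains to bound s. The sets P(v) are disjoint, so any independent
    subset of U of size t satisfies t(e/n - tk) <= n
    ([independent_degree_bound]). When e^2 >= 64 k n^3 this cannot hold for t
    just above 2n^2/e; as independence passes to subsets, s <= 2n^2/e
    ([independent_card_bound]). Then sk <= e/(32n), and P(v) is a clique on at
    least 31e/(32n) vertices ([exists_large_clique]).

    The combinatorial part is carried out over the natural numbers, with k
    replaced by the maximum codegree of a nonadjacent pair, and with
    inequalities between degrees multiplied by n to avoid division. *)

(** * Subsets of given size and private parts of a set family *)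

Lemma exists_subset_card (A : finType) (S : {set A}) t : (t <= #|S|)%N ->
  exists2 S' : {set A}, S' \subset S & #|S'| = t.
Proof.
move=> t_le; exists [set x in take t (enum S)].
  by apply/subsetP => x; rewrite inE => /mem_take; rewrite mem_enum.
rewrite cardsE (card_uniqP _) ?take_uniq ?enum_uniq // size_takel //.
by rewrite -cardE.
Qed.

Section PrivateParts.

Context {I T : finType}.
Implicit Types (F : I -> {set T}) (S : {set I}).

Definition private_part F S v : {set T} :=
  F v :\: \bigcup_(w in S :\ v) F w.

Lemma card_private_part F S v K :
  (forall w, w \in S -> v != w -> #|F v :&: F w| <= K)%N ->
  (#|F v| <= #|private_part F S v| + #|S| * K)%N.
Proof.
move=> cap_le.
rewrite -(cardsID (\bigcup_(w in S :\ v) F w)) addnC leq_add2l.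
rewrite big_distrr /=; apply: (@leq_trans (\sum_(w in S :\ v) K)%N).
  apply: (@leq_trans (\sum_(w in S :\ v) #|F v :&: F w|)%N).
    elim/big_ind2: _ => [|m A m' B le_A le_B|//]; first by rewrite cards0.
    by rewrite (leq_trans (leq_card_setU _ _)) // leq_add.
  by apply: leq_sum => w; rewrite !inE eq_sym => /andP[vw wS]; exact: cap_le.
by rewrite sum_nat_const leq_mul2r subset_leq_card ?orbT // subsetDl.
Qed.

(** The private parts are pairwise disjoint: each x is counted at most once. *)
Lemma sum_card_private_part F S :
  (\sum_(v in S) #|private_part F S v| <= #|T|)%N.
Proof.
under eq_bigr do rewrite -sum1_card big_mkcond.
rewrite exchange_big /= -sum1_card; apply: leq_sum => x _.
have [v /andP[vS xv]|none] :=
    pickP (fun v => (v \in S) && (x \in private_part F S v)); last first.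
  by rewrite big1 // => v vS; move: (none v); rewrite vS => /= ->.
rewrite (bigD1 v) //= xv big1 // => w /andP[wS wv]; case: ifP => // /setDP[_].
case/bigcupP; exists v; first by rewrite !inE eq_sym wv.
by case/setDP: xv.
Qed.

End PrivateParts.

(** * A subgraph of large minimum degree *)

Section CliqueInDenseGraph.

Context {T : finType} (E : {set {set T}}).
Hypothesis graphE : is_graph E.
Implicit Types (U S : {set T}).

Lemma nbrs_sym u v : (u \in nbrs E v) = (v \in nbrs E u).
Proof. by rewrite !inE setUC. Qed.

Lemma nbrs_irr v : v \notin nbrs E v.
Proof. by rewrite inE setUid; apply/negP => /graphE; rewrite cards1. Qed.

Definition induced_edges U := [set A in E | A \subset U].

(** The edges lost when v is deleted from U are the pairs [set v; u] with u a
    neighbour of v in U. *)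
Lemma card_induced_edgesD1 U v :
  (#|induced_edges U| <= #|induced_edges (U :\ v)| + #|nbrs E v :&: U|)%N.
Proof.
pose star := [set [set v; u] | u in nbrs E v :&: U].
apply: (@leq_trans #|induced_edges (U :\ v) :|: star|); last first.
  by rewrite (leq_trans (leq_card_setU _ _)) // leq_add2l leq_imset_card.
apply/subset_leq_card/subsetP => A; rewrite !inE => /andP[AE AU].
have [vA|vA] := boolP (v \in A); last by rewrite AE subsetD1 AU vA.
apply/orP; right; have /eqP/cards2P[a [b [_ Aab]]] := graphE _ AE.
suff [u Au] : exists u, A = [set v; u].
  apply/imsetP; exists u => //; rewrite !inE -Au AE (subsetP AU) //.
  by rewrite Au !inE eqxx orbT.
move: vA; rewrite Aab !inE => /orP[] /eqP ->; first by exists b.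
by exists a; rewrite setUC.
Qed.

(** Take U minimal among the nonempty sets whose induced edge density |E(U)|/|U|
    is at least the density |E|/|T| of the whole graph: deleting a vertex of
    degree less than |E|/|T| would not decrease the density. *)
Lemma exists_min_degree_subgraph : (0 < #|E|)%N ->
  exists2 U, U != set0 &
    forall v, v \in U -> (#|E| <= #|T| * #|nbrs E v :&: U|)%N.
Proof.
move=> E_gt0.
pose dense U := (U != set0) && (#|E| * #|U| <= #|T| * #|induced_edges U|)%N.
have denseT : dense setT.
  apply/andP; split.
    case/card_gt0P: E_gt0 => A /graphE A2; apply/eqP => T0.
    have A0 : A = set0 by apply/eqP; rewrite -subset0 -T0.
    by rewrite A0 cards0 in A2.
  rewrite cardsT mulnC leq_mul2l subset_leq_card ?orbT //.
  by apply/subsetP => A AE; rewrite inE AE subsetT.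
have [U /andP[U0 Udense] Umin] : exists2 U : {set T}, dense U &
    forall U' : {set T}, dense U' -> (#|U| <= #|U'|)%N.
  by case: (@arg_minnP _ _ dense (fun U => #|U|) denseT) => U; exists U.
exists U => // v vU.
have cardU : #|U| = #|U :\ v|.+1 by rewrite (cardsD1 v) vU.
have edges_le : (#|T| * #|induced_edges U| <=
    #|T| * #|induced_edges (U :\ v)| + #|T| * #|nbrs E v :&: U|)%N.
  by rewrite -mulnDr leq_mul2l card_induced_edgesD1 orbT.
(* If U is the singleton of v, minimality says nothing, as the empty set is
   excluded; but then every edge of U is counted at v. *)
have [UD0|UDn0] := eqVneq (U :\ v) set0.
  have no_edges : induced_edges (U :\ v) = set0.
    apply/setP => A; rewrite UD0 !inE subset0; apply/negP => /andP[/graphE].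
    by move=> + /eqP A0; rewrite A0 cards0.
  rewrite no_edges cards0 muln0 add0n in edges_le.
  rewrite (leq_trans _ edges_le) // (leq_trans _ Udense) //.
  by rewrite cardU UD0 cards0 muln1.
have : ~~ dense (U :\ v) by apply/negP => /Umin; rewrite cardU ltnn.
rewrite /dense UDn0 /= -ltnNge; move: Udense; rewrite cardU mulnS => ge_U lt_UD.
rewrite -(leq_add2l (#|T| * #|induced_edges (U :\ v)|)).
by rewrite (leq_trans _ edges_le) // (leq_trans _ ge_U) // addnC leq_add2l ltnW.
Qed.

(** * Maximum independent sets *)

(** The pairs with x = y may be included, since [set x; x] is a singleton and
    hence never an edge. *)
Definition independent S := [forall x in S, forall y in S, [set x; y] \notin E].

Lemma independentP S :
  reflect {in S &, forall x y, x \notin nbrs E y} (independent S).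
Proof.
apply: (iffP forall_inP) => [ind x y xS yS|ind x xS].
  by rewrite inE setUC; exact: (forall_inP (ind x xS)).
by apply/forall_inP => y yS; have := ind x y xS yS; rewrite inE setUC.
Qed.

(** Two nonadjacent vertices of the private part of v could be exchanged for v,
    which contradicts the maximality of S. *)
Lemma clique_private_part U S v :
  S \subset U -> independent S -> v \in S ->
  (forall S', S' \subset U -> independent S' -> (#|S'| <= #|S|)%N) ->
  is_clique E (private_part (fun w => nbrs E w :&: U) S v).
Proof.
move=> SU /independentP indS vS Smax x y xP yP xy; apply/negPn/negP => xyE.
(* z is outside S because it is adjacent to v, which lies in S. *)
have facts z : z \in private_part (fun w => nbrs E w :&: U) S v ->
    [/\ z \in U, z \notin S & {in S :\ v, forall w, z \notin nbrs E w}].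
  move=> /setDP[/setIP[zv zU] zN]; split=> //.
    by apply/negP => zS; have := indS z v zS vS; rewrite zv.
  move=> w wS; apply: contra zN => zw; apply/bigcupP; exists w => //.
  by rewrite inE zw.
have [xU xS xN] := facts x xP; have [yU yS yN] := facts y yP.
pose S' := x |: (y |: S :\ v).
have S'U : S' \subset U.
  rewrite !subUset !sub1set xU yU /=.
  by rewrite (subset_trans _ SU) // subsetDl.
have indS' : independent S'.
  have xNy : x \notin nbrs E y by rewrite inE setUC.
  have indD a b : a \in S :\ v -> b \in S :\ v -> a \notin nbrs E b.
    by move=> /setD1P[_ aS] /setD1P[_ bS]; exact: indS.
  apply/independentP => a b.
  move=> /setU1P[->|/setU1P[->|aS]] /setU1P[->|/setU1P[->|bS]].
  - exact: nbrs_irr.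
  - exact: xNy.
  - exact: xN.
  - by rewrite nbrs_sym.
  - exact: nbrs_irr.
  - exact: yN.
  - by rewrite nbrs_sym xN.
  - by rewrite nbrs_sym yN.
  - exact: indD.
have := Smax S' S'U indS'; rewrite /S' !cardsU1 !inE.
rewrite (negbTE xS) (negbTE yS) (negbTE xy) !andbF (cardsD1 v S) vS /=; lia.
Qed.

(** * The size of independent sets and of private parts *)

Context (K : nat).
Hypothesis codegree_le : forall i j : T, i != j -> [set i; j] \notin E ->
  (#|nbrs E i :&: nbrs E j| <= K)%N.

Lemma card_private_nbrs U S v : independent S -> v \in S ->
  (#|nbrs E v :&: U| <=
     #|private_part (fun w => nbrs E w :&: U) S v| + #|S| * K)%N.
Proof.
move=> /forall_inP indS vS; apply: card_private_part => w wS vw.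
apply: leq_trans (codegree_le _ _ vw (forall_inP (indS v vS) w wS)).
by apply/subset_leq_card/setISS; exact: subsetIl.
Qed.

(** Each of the disjoint private parts has at least d/|T| - |S| * K elements, and
    together they have at most |T|. *)
Lemma independent_degree_bound U S d : independent S ->
  (forall v, v \in S -> d <= #|T| * #|nbrs E v :&: U|)%N ->
  (#|S| * d <= #|T| * #|T| + #|T| * (#|S| * (#|S| * K)))%N.
Proof.
move=> indS deg.
have sum_le := sum_card_private_part (fun w => nbrs E w :&: U) S.
rewrite -[leqLHS]sum_nat_const.
apply: (@leq_trans (\sum_(v in S)
    (#|T| * #|private_part (fun w => nbrs E w :&: U) S v|
     + #|T| * (#|S| * K)))%N).
  apply: leq_sum => v vS; apply: leq_trans (deg v vS) _.
  by rewrite -mulnDr leq_mul2l card_private_nbrs ?orbT.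
rewrite big_split /= -big_distrr /= sum_nat_const.
by rewrite [(#|S| * (_ * _))%N]mulnCA leq_add2r leq_mul2l sum_le orbT.
Qed.

(** The inequality of [independent_degree_bound] is quadratic in the size of the
    independent set, so it excludes only a range of sizes. A larger set S would
    contain a subset whose size t lies in that range: t is the least integer
    above 2|T|^2/|E|, so that t|E| is between 2|T|^2 and 3|T|^2. *)
Lemma independent_card_bound U S :
  (64 * #|T| ^ 3 * K <= #|E| ^ 2)%N -> (0 < #|E|)%N -> independent S ->
  (forall v, v \in S -> #|E| <= #|T| * #|nbrs E v :&: U|)%N ->
  (#|S| * #|E| <= 2 * #|T| ^ 2)%N.
Proof.
move=> dense E_gt0 indS deg; rewrite leqNgt; apply/negP => S_big.
pose t := (2 * #|T| ^ 2 %/ #|E|).+1.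
have t_le : (t <= #|S|)%N by rewrite ltn_divLR.
have t_gt : (2 * #|T| ^ 2 < t * #|E|)%N by rewrite ltn_ceil.
have t_pred : (t.-1 * #|E| <= 2 * #|T| ^ 2)%N by exact: leq_trunc_div.
have [S' S'S cardS'] := exists_subset_card _ _ _ t_le.
have E_le : (#|E| <= #|T| * #|T|)%N.
  case/card_gt0P: (leq_trans (ltn0Sn _) t_le) => v vS.
  by apply: leq_trans (deg v vS) _; rewrite leq_mul2l max_card orbT.
have indS' : independent S'.
  apply/independentP => x y /(subsetP S'S) xS /(subsetP S'S) yS.
  exact: (independentP _ indS).
have := independent_degree_bound U S' #|E| indS'
  (fun v vS' => deg v (subsetP S'S v vS')).
rewrite cardS'.
have tE_le : (t * #|E| <= 3 * #|T| ^ 2)%N.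
  by move: t_pred E_le; rewrite /=; nia.
have n_gt0 : (0 < #|T|)%N by nia.
have : (64 * (K * t ^ 2) <= 9 * #|T|)%N.
  rewrite -(@leq_pmul2r (#|T| ^ 3)) ?expn_gt0 ?n_gt0 //.
  apply: (@leq_trans (#|E| ^ 2 * t ^ 2)%N).
    by rewrite (leq_trans _ (leq_mul dense (leqnn _))) //; apply: eq_leq; ring.
  apply: (leq_trans (n := (3 * #|T| ^ 2) ^ 2)).
    by rewrite -expnMn leq_sqr mulnC.
  by apply: eq_leq; ring.
nia.
Qed.

(** The clique is the private part of any element of a maximum independent
    subset of a subgraph of large minimum degree. *)
Theorem exists_large_clique :
  (0 < #|E|)%N -> (64 * #|T| ^ 3 * K <= #|E| ^ 2)%N ->
  exists2 C : {set T}, is_clique E C & (31 * #|E| <= 32 * (#|T| * #|C|))%N.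
Proof.
move=> E_gt0 dense.
have [U U0 deg] := exists_min_degree_subgraph E_gt0.
pose P (S : {set T}) := (S \subset U) && independent S.
have P0 : P set0 by rewrite /P sub0set; apply/independentP => x; rewrite inE.
case: (@arg_maxnP _ _ P (fun S => #|S|) P0) => S /andP[SU indS] Smax.
have degS v : v \in S -> (#|E| <= #|T| * #|nbrs E v :&: U|)%N.
  by move/(subsetP SU); exact: deg.
have [v vS] : exists v, v \in S.
  have [u uU] := set0Pn _ U0; apply/set0Pn; rewrite -card_gt0.
  rewrite (leq_trans _ (Smax [set u] _)) ?cards1 // /P sub1set uU /=.
  by apply/independentP => x y /set1P -> /set1P ->; rewrite nbrs_irr.
exists (private_part (fun w => nbrs E w :&: U) S v).
  apply: clique_private_part => // S' S'U indS'.
  by apply: Smax; rewrite /P S'U.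
have S_le := independent_card_bound U S dense E_gt0 indS degS.
have := card_private_nbrs U S v indS vS.
move: (degS v vS) S_le dense.
set p := #|private_part _ _ _|; set d := #|_ :&: _|.
move=> deg_v S_le dense d_le.
(* The loss |S| * K is at most 1/32 of |E|/|T|, since |S| <= 2|T|^2/|E| and
   64 |T|^3 K <= |E|^2. *)
have waste : (32 * (#|T| * (#|S| * K)) <= #|E|)%N.
  rewrite -(@leq_pmul2r #|E|) //.
  apply: (leq_trans _ (n := #|E| ^ 2)) => //.
  apply: leq_trans dense.
  apply: (@leq_trans (32 * (#|T| * K) * (#|S| * #|E|))%N).
    by apply: eq_leq; ring.
  apply: (leq_trans (leq_mul (leqnn _) S_le)); apply: eq_leq; ring.
nia.
Qed.

End CliqueInDenseGraph.

(** * The bound with a real codegree parameter *)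

Theorem theorem2 (R : rcfType) (k : R) (n : nat) (E : {set {set 'I_n}})
    (hk : 1 <= k) (hn : (1 <= n)%N) (hE : is_graph E)
    (hcodeg : forall i j : 'I_n, i != j -> [set i; j] \notin E ->
       #|nbrs E i :&: nbrs E j|%:R <= k)
    (hedges : 8%:R * n%:R * Num.sqrt (k * n%:R) <= #|E|%:R) :
  exists S : {set 'I_n},
    is_clique E S /\ 1 / 4%:R * (#|E|%:R / n%:R) <= #|S|%:R :> R.
Proof.
have n_gt0 : 0 < n%:R :> R by rewrite ltr0n.
have kn_gt0 : 0 < k * n%:R by rewrite mulr_gt0 // (lt_le_trans ltr01).
have E_gt0 : (0 < #|E|)%N.
  by rewrite -(ltr0n R) (lt_le_trans _ hedges) // !mulr_gt0 ?sqrtr_gt0.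
pose nonadj (p : 'I_n * 'I_n) := (p.1 != p.2) && ([set p.1; p.2] \notin E).
pose K := (\max_(p | nonadj p) #|nbrs E p.1 :&: nbrs E p.2|)%N.
have codeg_K i j : i != j -> [set i; j] \notin E ->
    (#|nbrs E i :&: nbrs E j| <= K)%N.
  move=> ij ijE.
  by apply: (leq_bigmax_cond (i, j)); rewrite /nonadj /= ij.
have K_le : K%:R <= k.
  rewrite /K; elim/big_ind: _ => [|a b a_le b_le|p /andP[pn pE]].
  - exact: le_trans ler01 hk.
  - by rewrite /maxn; case: ifP.
  - exact: hcodeg.
have dense : (64 * n ^ 3 * K <= #|E| ^ 2)%N.
  rewrite -(ler_nat R) (_ : _%:R = 64%:R * n%:R ^+ 3 * K%:R); last by ring.
  rewrite [leRHS]natrX.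
  have : (8%:R * n%:R * Num.sqrt (k * n%:R)) ^+ 2 <= #|E|%:R ^+ 2.
    by rewrite lerXn2r // nnegrE ?ler0n // !mulr_ge0 ?sqrtr_ge0 ?ler0n.
  apply: le_trans; rewrite exprMn sqr_sqrtr ?(ltW kn_gt0) //.
  have -> : (8%:R * n%:R) ^+ 2 * (k * n%:R) = 64%:R * n%:R ^+ 3 * k by ring.
  by rewrite ler_wpM2l // mulr_ge0 // exprn_ge0.
have [|S cliqueS S_ge] := @exists_large_clique _ E hE K codeg_K E_gt0.
  by rewrite card_ord.
exists S; split=> //.
rewrite div1r mulrA ler_pdivrMr // mulrC ler_pdivrMr ?ltr0n //.
rewrite -!natrM ler_nat.
move: S_ge; rewrite card_ord; lia.
Qed.
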